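(* Let $0<\lambda<1$ and assume that $A$ satisfies the twist condition, that there is a finite number of turning points, and that each turning point is simple. Then the upper boundary $\mathcal{B}_\lambda$ of the attractor of $F(x,s)=(T(x),\lambda s+A(x))$, i.e. the graph of the $\lambda$-calibrated subaction $b$, is given by a finite number of $C^2$ pieces, each of which is a piece of an unstable manifold of $F$ (a piece of the graph of $S(\cdot,a)$ for some $a\in\Sigma$).
   Context: Let $d\ge 2$ be an integer, $T(x)=dx\pmod 1$ on $S^1=\mathbb{R}/\mathbb{Z}$, $0<\lambda<1$, and $A:S^1\to\mathbb{R}$ Lipschitz. $S^1$ is identified with $[0,1)$, and functions on $S^1$ are also regarded as functions on $[0,1]$ with equal values at $0$ and $1$. Here $A$ is assumed of class $C^2$ as a function on $[0,1]$. Inverse branches: $\tau_i:[0,1]\to[0,1]$, $\tau_i(x)=(x+i-1)/d$, $i=1,\dots,d$. $\Sigma=\{1,\dots,d\}^{\mathbb{N}}$, $a=(a_0,a_1,\dots)$, ordered lexicographically. $\tau_{k,a}=\tau_{a_k}\circ\cdots\circ\tau_{a_0}$ and $S(x,a)=\sum_{k\ge0}\lambda^kA(\tau_{k,a}x)$. The $\lambda$-calibrated subaction is the unique continuous $b:S^1\to\mathbb{R}$ with $b(x)=\max_i\{\lambda b(\tau_i x)+A(\tau_i x)\}$ for all $x$. Twist condition: for all $a<b'$ in $\Sigma$ and $x\in(0,1)$, $\frac{\partial S}{\partial x}(x,a)-\frac{\partial S}{\partial x}(x,b')>0$. A turning point is a point $x\in S^1$ such that $b(x)=\lambda b(\tau_i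 x)+A(\tau_i x)$ for more than one symbol $i$; it is simple if its forward orbit $\{T^n(x):n\ge0\}$ is finite. The attractor of $F:S^1\times\mathbb{R}\to S^1\times\mathbb{R}$ is the set of all $(x,s)$ having a bounded infinite backward orbit under $F$; its upper boundary $\mathcal{B}_\lambda$ consists of the highest point of the attractor over each $x$, and it is the graph of $b$. The unstable manifolds (leaves) of $F$ are the curves $\{(x,S(x,a)):x\in(0,1)\}$, $a\in\Sigma$. *)

(* Defs.v *)
From Stdlib Require Export Reals Finite_sets.
From Coquelicot Require Export Coquelicot.
Open Scope R_scope.

(* Stdlib and Coquelicot.

   Conventions for the circle S^1 = R/Z.  A point of S^1 is given by its
   representative in [0,1); a function on S^1 is given by a 1-periodic function
   on R, so that continuity and Lipschitz continuity on R are continuity and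
   Lipschitz continuity on the circle, while the restriction to [0,1] is the
   associated function on [0,1] with equal values at 0 and 1. *)

Definition in_circle (x : R) : Prop := 0 <= x < 1.

Definition periodic1 (f : R -> R) : Prop := forall x : R, f (x + 1) = f x.

Definition lipschitz (f : R -> R) : Prop :=
  exists K : R, forall x y : R, Rabs (f x - f y) <= K * Rabs (x - y).

(* Derivatives and continuity are relative to [u,v], hence one-sided at u and v:
   a function of class C^2 on [0,1] need not be C^2 on the circle. *)
Definition C2_on (u v : R) (f : R -> R) : Prop :=
  exists f1 f2 : R -> R, forall x : R, u <= x <= v ->
    D_in f f1 (fun y => u <= y <= v) x /\
    D_in f1 f2 (fun y => u <= y <= v) x /\
    continue_in f2 (fun y => u <= y <= v) x.

Definition Tmap (d : nat) (x : R) : R := frac_part (INR d * x).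

Definition symbol (d i : nat) : Prop := (1 <= i <= d)%nat.

Definition tau (d i : nat) (x : R) : R := (x + INR i - 1) / INR d.

Definition Sigma (d : nat) (a : nat -> nat) : Prop := forall k : nat, symbol d (a k).

Definition lex_lt (a b : nat -> nat) : Prop :=
  exists n : nat, (forall k : nat, (k < n)%nat -> a k = b k) /\ (a n < b n)%nat.

Fixpoint tau_seq (d k : nat) (a : nat -> nat) (x : R) : R :=
  match k with
  | O => tau d (a O) x
  | S k' => tau d (a k) (tau_seq d k' a x)
  end.

Definition Sfun (d : nat) (lam : R) (A : R -> R) (x : R) (a : nat -> nat) : R :=
  Series (fun k : nat => lam ^ k * A (tau_seq d k a x)).

Definition twist_condition (d : nat) (lam : R) (A : R -> R) : Prop :=
  forall a b : nat -> nat, Sigma d a -> Sigma d b -> lex_lt a b ->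
  forall x : R, 0 < x < 1 ->
    Derive (fun y => Sfun d lam A y a) x - Derive (fun y => Sfun d lam A y b) x > 0.

Definition branch_value (d : nat) (lam : R) (A b : R -> R) (i : nat) (x : R) : R :=
  lam * b (tau d i x) + A (tau d i x).

Definition is_maximum (E : R -> Prop) (m : R) : Prop := E m /\ is_upper_bound E m.

Definition calibrated_subaction (d : nat) (lam : R) (A b : R -> R) : Prop :=
  periodic1 b /\ continuity b /\
  forall x : R, in_circle x ->
    is_maximum (fun y => exists i : nat, symbol d i /\ y = branch_value d lam A b i x)
      (b x).

Definition turning_point (d : nat) (lam : R) (A b : R -> R) (x : R) : Prop :=
  in_circle x /\
  exists i j : nat, symbol d i /\ symbol d j /\ i <> j /\
    b x = branch_value d lam A b i x /\ b x = branch_value d lam A b j x.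

Definition forward_orbit (d : nat) (x : R) : R -> Prop :=
  fun y => exists n : nat, y = Nat.iter n (Tmap d) x.

Definition simple_point (d : nat) (x : R) : Prop := Finite_sets.Finite R (forward_orbit d x).

Definition Fmap (d : nat) (lam : R) (A : R -> R) (p : R * R) : R * R :=
  (Tmap d (fst p), lam * snd p + A (fst p)).

(* As S^1 is compact, an orbit is bounded when its second coordinates are. *)
Definition attractor (d : nat) (lam : R) (A : R -> R) (p : R * R) : Prop :=
  exists z : nat -> R * R,
    z O = p /\
    (forall n : nat, in_circle (fst (z n))) /\
    (forall n : nat, Fmap d lam A (z (S n)) = z n) /\
    exists M : R, forall n : nat, Rabs (snd (z n)) <= M.

Definition upper_boundary (d : nat) (lam : R) (A : R -> R) (p : R * R) : Prop :=
  attractor d lam A p /\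
  forall s : R, attractor d lam A (fst p, s) -> s <= snd p.

Definition unstable_manifold (d : nat) (lam : R) (A : R -> R) (a : nat -> nat)
    (p : R * R) : Prop :=
  0 < fst p < 1 /\ snd p = Sfun d lam A (fst p) a.

(* Main.v *)
(** Let [P] be the union of the forward orbits of the turning points: it is finite
    and [T P] is contained in [P].  On an interval of [(0,1)] avoiding [P] there is
    no turning point, so by connectedness a single branch [i] realizes the maximum;
    the image of the interval under [tau i] avoids [P] again, since [T] sends it back
    to the interval.  Iterating, one itinerary [a] is optimal for all points of the
    interval at once, and unfolding the calibration equation gives [b = S(., a)]
    there, up to the endpoints by continuity.  [S(., a)] is [C^2] by termwise
    differentiation. *)
Require Import Defs.
From Stdlib Require Import Lra Lia Classical IndefiniteDescription ZArith List.
Set Bullet Behavior "Strict Subproofs".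

(** * Series dominated by a geometric series: limits and derivatives term by term *)

Lemma ex_series_geom_dom (a : nat -> R) (M r : R) :
  0 <= r < 1 -> (forall k, Rabs (a k) <= M * r ^ k) -> ex_series a.
Proof.
intros Hr Ha.
apply (ex_series_le a (fun k => M * r ^ k)); [exact Ha|].
apply (ex_series_scal (V := R_NormedModule) M (fun k => r ^ k)).
exists (/ (1 - r)); apply is_series_geom; rewrite Rabs_right; lra.
Qed.

Lemma Series_geom_bound (a : nat -> R) (M r : R) :
  0 <= r < 1 -> (forall k, Rabs (a k) <= M * r ^ k) ->
  Rabs (Series a) <= M / (1 - r).
Proof.
intros Hr Ha.
assert (Hg : ex_series (fun k => M * r ^ k)).
{ apply (ex_series_geom_dom _ (Rabs M) r Hr); intros k.
  rewrite Rabs_mult, (Rabs_right (r ^ k)); [lra|].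
  apply Rle_ge, pow_le; lra. }
assert (Ha' : ex_series (fun k => Rabs (a k))).
{ apply (ex_series_geom_dom _ M r Hr); intros k; rewrite Rabs_Rabsolu; apply Ha. }
eapply Rle_trans; [apply Series_Rabs, Ha'|].
eapply Rle_trans.
- apply (Series_le _ (fun k => M * r ^ k)); [|exact Hg].
  intros k; split; [apply Rabs_pos|apply Ha].
- rewrite Series_scal_l, Series_geom; [unfold Rdiv; lra|].
  rewrite Rabs_right; lra.
Qed.

Lemma limit1_in_sum_f_R0 (h : nat -> R -> R) (l : nat -> R) (D : R -> Prop) (x0 : R) (n : nat) :
  (forall k, limit1_in (h k) D (l k) x0) ->
  limit1_in (fun x => sum_f_R0 (fun k => h k x) n) D (sum_f_R0 l n) x0.
Proof.
intros Hl; induction n as [|n IH]; simpl; [apply Hl|].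
apply limit_plus; [exact IH|apply Hl].
Qed.

(** Tannery's theorem: far enough out, both series have tails that are small uniformly in [x], and
    the remaining finite sum passes to the limit termwise. *)
Lemma limit1_in_Series (h : nat -> R -> R) (l : nat -> R) (M r : R)
  (D : R -> Prop) (x0 : R) :
  0 <= r < 1 ->
  (forall k x, D x -> Rabs (h k x) <= M * r ^ k) ->
  (forall k, Rabs (l k) <= M * r ^ k) ->
  (forall k, limit1_in (h k) D (l k) x0) ->
  limit1_in (fun x => Series (fun k => h k x)) D (Series l) x0.
Proof.
intros Hr Hh Hl Hlim eps Heps.
assert (HM : 0 <= M).
{ specialize (Hl 0%nat); simpl in Hl; pose proof (Rabs_pos (l 0%nat)); lra. }
(* Chosen so that (M+1) e / (1-r) = eps/4: a tail bounded by M r^(N+1) / (1-r) then stays below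
   eps/4. Using M+1 avoids division by zero and makes the bound strict. *)
set (e := eps * (1 - r) / (4 * (M + 1))).
assert (He : 0 < e).
{ unfold e; apply Rdiv_lt_0_compat; [apply Rmult_lt_0_compat|]; lra. }
destruct (pow_lt_1_zero r ltac:(rewrite Rabs_right; lra) e He) as [N HN].
specialize (HN (S N) ltac:(lia)).
rewrite Rabs_right in HN by (apply Rle_ge, pow_le; lra).
destruct (limit1_in_sum_f_R0 h l D x0 N Hlim (eps / 2) ltac:(lra)) as [del [Hdel Hs]].
exists del; split; [exact Hdel|].
intros x [HDx Hx].
specialize (Hs x (conj HDx Hx)).
simpl in Hs |- *; unfold Rdist in Hs |- *.
assert (Htail : forall f : nat -> R, (forall k, Rabs (f k) <= M * r ^ k) ->
  Rabs (Series (fun k => f (S N + k)%nat)) < eps / 4).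
{ intros f Hf.
  eapply Rle_lt_trans.
  - apply (Series_geom_bound _ (M * r ^ S N) r Hr).
    intros k; eapply Rle_trans; [apply Hf|].
    rewrite pow_add; lra.
  - apply (Rmult_lt_reg_r (1 - r)); [lra|].
    unfold Rdiv at 1; rewrite Rmult_assoc, Rinv_l, Rmult_1_r by lra.
    apply Rle_lt_trans with (M * e); [apply Rmult_le_compat_l; lra|].
    replace (eps / 4 * (1 - r)) with ((M + 1) * e) by (unfold e; field; lra).
    lra. }
rewrite (Series_incr_n (fun k => h k x) (S N)), (Series_incr_n l (S N));
  try lia; try (apply (ex_series_geom_dom _ M r Hr); auto).
simpl Init.Nat.pred.
pose proof (Htail (fun k => h k x) (fun k => Hh k x HDx)) as H1.
pose proof (Htail l Hl) as H2.
cbv beta in H1.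
apply Rabs_def2 in H1; apply Rabs_def2 in H2; apply Rabs_def2 in Hs.
apply Rabs_def1; lra.
Qed.

(** The difference quotients form a series whose terms are dominated through the Lipschitz bounds,
    so the dominated limit applies to them. *)
Lemma D_in_Series (g g1 : nat -> R -> R) (M r : R) (D : R -> Prop) (x0 : R) :
  0 <= r < 1 -> D x0 ->
  (forall k x, D x -> Rabs (g k x) <= M * r ^ k) ->
  (forall k x y, D x -> D y -> Rabs (g k x - g k y) <= M * r ^ k * Rabs (x - y)) ->
  (forall k, Rabs (g1 k x0) <= M * r ^ k) ->
  (forall k, D_in (g k) (g1 k) D x0) ->
  D_in (fun x => Series (fun k => g k x)) (fun x => Series (fun k => g1 k x)) D x0.
Proof.
intros Hr Hx0 Hg HL Hg1 HD eps Heps.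
destruct (limit1_in_Series (fun k x => (g k x - g k x0) / (x - x0)) (fun k => g1 k x0)
   M r (D_x D x0) x0 Hr) with (eps := eps) as [del [Hdel H]]; auto.
- intros k x [Hx Hne].
  assert (0 < Rabs (x - x0)) by (apply Rabs_pos_lt; lra).
  unfold Rdiv; rewrite Rabs_mult, Rabs_inv.
  apply (Rmult_le_reg_r (Rabs (x - x0))); [lra|].
  rewrite Rmult_assoc, Rinv_l, Rmult_1_r by lra; auto.
- exists del; split; [exact Hdel|].
  intros x [[Hx Hne] Hd].
  specialize (H x (conj (conj Hx Hne) Hd)).
  rewrite <- Series_minus by (apply (ex_series_geom_dom _ M r Hr); auto).
  unfold Rdiv; rewrite <- Series_scal_r; exact H.
Qed.

(** * Functions on [0,1] with one-sided limits and derivatives at the endpoints *)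

(** The retraction of the line onto [0,1]. Composing with it turns continuity relative to [0,1] into
    continuity on the line, where the classical theorems are stated. *)
Definition clamp (x : R) : R := Rmax 0 (Rmin 1 x).

Lemma clamp_range (x : R) : 0 <= clamp x <= 1.
Proof.
unfold clamp; split; [apply Rmax_l|].
apply Rmax_lub; [lra|apply Rmin_l].
Qed.

Lemma clamp_id (x : R) : 0 <= x <= 1 -> clamp x = x.
Proof. intros H; unfold clamp; rewrite Rmin_right, Rmax_right; lra. Qed.

Lemma clamp_contract (x y : R) : Rabs (clamp x - clamp y) <= Rabs (x - y).
Proof.
unfold clamp, Rmax, Rmin.
repeat destruct Rle_dec; unfold Rabs; repeat destruct Rcase_abs; lra.
Qed.

Lemma continuity_clamp (f : R -> R) :
  (forall x, 0 <= x <= 1 -> continue_in f (fun y => 0 <= y <= 1) x) ->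
  continuity (fun x => f (clamp x)).
Proof.
intros Hf x eps Heps.
destruct (Hf (clamp x) (clamp_range x) eps Heps) as [del [Hdel H]].
exists del; split; [exact Hdel|].
intros y [_ Hy].
(* Relative limits exclude the centre itself, but [clamp] may identify distinct points, so that case
   is treated apart. *)
destruct (Req_dec (clamp y) (clamp x)) as [E|E].
- simpl; unfold Rdist; rewrite E, Rminus_diag, Rabs_R0; lra.
- apply H; split.
  + split; [apply clamp_range|auto].
  + eapply Rle_lt_trans; [apply clamp_contract|exact Hy].
Qed.

Lemma continuity_bounded (f : R -> R) (u v : R) :
  u <= v -> continuity f -> exists M, forall x, u <= x <= v -> Rabs (f x) <= M.
Proof.
intros Huv Hf.
destruct (continuity_ab_maj (fun x => Rabs (f x)) u v Huv) as [m [Hm _]].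
- intros x _.
  apply (continuity_pt_comp f Rabs); [apply Hf|apply Rcontinuity_abs].
- exists (Rabs (f m)); exact Hm.
Qed.

Lemma continue_in_bounded (f : R -> R) :
  (forall x, 0 <= x <= 1 -> continue_in f (fun y => 0 <= y <= 1) x) ->
  exists M, forall x, 0 <= x <= 1 -> Rabs (f x) <= M.
Proof.
intros Hf.
destruct (continuity_bounded _ 0 1 ltac:(lra) (continuity_clamp f Hf)) as [M HM].
exists M; intros x Hx; rewrite <- (clamp_id x Hx); apply HM, Hx.
Qed.

(** Mean value theorem for [f] composed with [clamp], which is continuous everywhere and has
    derivative [f1] at interior points. *)
Lemma D_in_lipschitz (f f1 : R -> R) (M : R) :
  (forall x, 0 <= x <= 1 -> D_in f f1 (fun y => 0 <= y <= 1) x) ->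
  (forall x, 0 <= x <= 1 -> Rabs (f1 x) <= M) ->
  forall x y, 0 <= x <= 1 -> 0 <= y <= 1 -> Rabs (f x - f y) <= M * Rabs (x - y).
Proof.
intros HD HM x y Hx Hy.
destruct (MVT_gen (fun z => f (clamp z)) y x f1) as [c [Hc E]].
- intros z Hz.
  assert (0 < z < 1).
  { unfold Rmin, Rmax in Hz; destruct (Rle_dec y x); lra. }
  apply is_derive_Reals.
  intros eps Heps.
  destruct (HD z ltac:(lra) eps Heps) as [del [Hdel Hlim]].
  (* The radius is also limited by z and 1-z, so that z+h stays in (0,1), where [clamp] is the
     identity. *)
  assert (Hm : 0 < Rmin del (Rmin z (1 - z))) by (repeat apply Rmin_glb_lt; lra).
  exists (mkposreal _ Hm); simpl; intros h Hh Hd.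
  assert (Rabs h < del /\ Rabs h < z /\ Rabs h < 1 - z) as [H1 [H2 H3]].
  { repeat split; eapply Rlt_le_trans; try exact Hd; unfold Rmin;
      repeat destruct Rle_dec; lra. }
  apply Rabs_def2 in H2; apply Rabs_def2 in H3.
  rewrite !clamp_id by lra.
  specialize (Hlim (z + h)); simpl in Hlim; unfold Rdist in Hlim.
  replace (z + h - z) with h in Hlim by ring.
  apply Hlim; split; [split; lra|exact H1].
- intros z _; apply (continuity_clamp f).
  intros w Hw; exact (cont_deriv _ _ _ _ (HD w Hw)).
- assert (0 <= c <= 1).
  { unfold Rmin, Rmax in Hc; destruct (Rle_dec y x); lra. }
  rewrite !clamp_id in E by lra.
  rewrite E, Rabs_mult.
  apply Rmult_le_compat_r; [apply Rabs_pos|auto].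
Qed.

(** * Regularity of S(., a) *)

Lemma tau_seq_affine (d k : nat) (a : nat -> nat) (x : R) :
  (1 <= d)%nat -> tau_seq d k a x = tau_seq d k a 0 + x * / INR d ^ S k.
Proof.
intros Hd; assert (INR d <> 0) by (apply not_0_INR; lia).
induction k as [|k IH].
- simpl; unfold tau; field; auto.
- change (tau_seq d (S k) a x) with (tau d (a (S k)) (tau_seq d k a x)).
  change (tau_seq d (S k) a 0) with (tau d (a (S k)) (tau_seq d k a 0)).
  rewrite IH; unfold tau; simpl; field; auto using pow_nonzero.
Qed.

Lemma tau_range (d i : nat) (x : R) :
  symbol d i -> 0 <= x <= 1 -> 0 <= tau d i x <= 1.
Proof.
intros [H1 H2] Hx; unfold tau.
apply le_INR in H1; apply le_INR in H2; change (INR 1) with 1 in H1.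
split.
- apply Rdiv_le_0_compat; lra.
- apply Rle_div_l; lra.
Qed.

Lemma tau_seq_range (d k : nat) (a : nat -> nat) (x : R) :
  Sigma d a -> 0 <= x <= 1 -> 0 <= tau_seq d k a x <= 1.
Proof.
intros Ha Hx; induction k as [|k IH]; apply tau_range; auto.
Qed.

Section Weighted.

Variables (d : nat) (a : nat -> nat) (r : R).
Hypotheses (hd : (1 <= d)%nat) (ha : Sigma d a) (hr : 0 <= r < 1).

(** With [f] equal to A, A', A'' and weights lambda^k, lambda^k / d^(k+1), lambda^k / d^(2(k+1)),
    this is S(., a) and its first two derivatives, so one differentiation rule serves twice. *)
Definition weighted_sum (f : R -> R) (w : nat -> R) (x : R) : R :=
  Series (fun k => w k * f (tau_seq d k a x)).

Lemma inv_pow_range (k : nat) : 0 < / INR d ^ S k <= 1.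
Proof.
assert (1 <= INR d) by (apply (le_INR 1); exact hd).
split; [apply Rinv_0_lt_compat, pow_lt; lra|].
rewrite <- Rinv_1; apply Rinv_le_contravar; [lra|apply pow_R1_Rle; lra].
Qed.

Lemma weighted_bound (f : R -> R) (w : nat -> R) (M : R) (k : nat) (x : R) :
  (forall x, 0 <= x <= 1 -> Rabs (f x) <= M) -> (forall k, Rabs (w k) <= r ^ k) ->
  0 <= x <= 1 -> Rabs (w k * f (tau_seq d k a x)) <= M * r ^ k.
Proof.
intros Hf Hw Hx; rewrite Rabs_mult, Rmult_comm.
apply Rmult_le_compat; auto using Rabs_pos, tau_seq_range.
Qed.

Lemma D_in_tau_seq (f f1 : R -> R) (u v x : R) (k : nat) :
  0 <= u -> v <= 1 -> u <= x <= v ->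
  (forall x, 0 <= x <= 1 -> D_in f f1 (fun y => 0 <= y <= 1) x) ->
  D_in (fun x => f (tau_seq d k a x)) (fun x => / INR d ^ S k * f1 (tau_seq d k a x))
    (fun y => u <= y <= v) x.
Proof.
intros Hu Hv Hx Hf eps Heps.
destruct (Dcomp (fun y => u <= y <= v) (fun y => 0 <= y <= 1)
  (fun _ => / INR d ^ S k) f1 (fun x => tau_seq d k a x) f x) with (eps := eps)
  as [del [Hdel H]]; auto.
- intros e He; exists 1; split; [lra|].
  intros y [[_ Hy] _]; rewrite (tau_seq_affine d k a y), (tau_seq_affine d k a x) by lia.
  simpl dist; unfold Rdist.
  match goal with |- Rabs ?t < _ => replace t with 0 end; [rewrite Rabs_R0; lra|].
  assert (INR d <> 0) by (apply not_0_INR; lia).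
  field; auto using pow_nonzero, Rminus_eq_contra.
- apply Hf, tau_seq_range; auto; lra.
- exists del; split; [exact Hdel|].
  intros y [[Hy Hne] Hd]; apply H; repeat split; auto; try lra;
    apply tau_seq_range; auto; lra.
Qed.

(** The chain rule multiplies each weight by the slope of [tau_seq]. This slope is at most 1, so the
    same geometric series dominates both the Lipschitz constants and the derived terms. *)
Lemma D_in_weighted_sum (f f1 : R -> R) (w : nat -> R) (u v x : R) :
  0 <= u -> v <= 1 -> u <= x <= v ->
  (forall x, 0 <= x <= 1 -> D_in f f1 (fun y => 0 <= y <= 1) x) ->
  (exists M, forall x, 0 <= x <= 1 -> Rabs (f1 x) <= M) ->
  (forall k, Rabs (w k) <= r ^ k) ->
  D_in (weighted_sum f w) (weighted_sum f1 (fun k => w k * / INR d ^ S k))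
    (fun y => u <= y <= v) x.
Proof.
intros Hu Hv Hx Hf [M1 HM1] Hw.
destruct (continue_in_bounded f) as [M0 HM0].
{ intros y Hy; exact (cont_deriv _ _ _ _ (Hf y Hy)). }
pose proof (D_in_lipschitz f f1 M1 Hf HM1) as HL.
(* One constant bounding the values of [f] and of [f1], hence also the Lipschitz constant of [f]. *)
set (M := Rmax M0 M1).
assert (HM0' : forall x, 0 <= x <= 1 -> Rabs (f x) <= M).
{ intros y Hy; eapply Rle_trans; [apply HM0, Hy|apply Rmax_l]. }
assert (HM1' : forall x, 0 <= x <= 1 -> Rabs (f1 x) <= M).
{ intros y Hy; eapply Rle_trans; [apply HM1, Hy|apply Rmax_r]. }
assert (HMpos : 0 <= M1) by (eapply Rle_trans; [apply Rabs_pos|apply (HM1 0); lra]).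
apply (D_in_Series (fun k y => w k * f (tau_seq d k a y))
         (fun k y => w k * / INR d ^ S k * f1 (tau_seq d k a y)) M r); auto.
- intros k y Hy; apply weighted_bound; auto; lra.
- intros k y z Hy Hz.
  rewrite <- Rmult_minus_distr_l, Rabs_mult, (Rmult_comm M), Rmult_assoc.
  apply Rmult_le_compat; auto using Rabs_pos.
  eapply Rle_trans; [apply HL; apply tau_seq_range; auto; lra|].
  apply Rmult_le_compat; auto using Rabs_pos; [apply Rmax_r|].
  rewrite (tau_seq_affine d k a y), (tau_seq_affine d k a z) by lia.
  match goal with |- Rabs ?t <= _ => replace t with ((y - z) * / INR d ^ S k) by ring end.
  pose proof (inv_pow_range k); pose proof (Rabs_pos (y - z)).
  rewrite Rabs_mult, (Rabs_right (/ _)) by lra; nra.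
- intros k; apply (weighted_bound f1 (fun k => w k * / INR d ^ S k)); auto; [|lra].
  intros j; pose proof (inv_pow_range j); pose proof (Rabs_pos (w j)); specialize (Hw j).
  rewrite Rabs_mult, (Rabs_right (/ _)) by lra; nra.
- intros k eps Heps.
  destruct (Dmult_const (fun y => u <= y <= v) (fun x => f (tau_seq d k a x))
    (fun x => / INR d ^ S k * f1 (tau_seq d k a x)) x (w k)
    (D_in_tau_seq f f1 u v x k Hu Hv Hx Hf) eps Heps) as [del [Hdel H]].
  exists del; split; [exact Hdel|]; intros y Hy; rewrite Rmult_assoc; apply H, Hy.
Qed.

Lemma continue_in_weighted_sum (f : R -> R) (w : nat -> R) (u v x : R) :
  0 <= u -> v <= 1 -> u <= x <= v ->
  (forall x, 0 <= x <= 1 -> continue_in f (fun y => 0 <= y <= 1) x) ->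
  (forall k, Rabs (w k) <= r ^ k) ->
  continue_in (weighted_sum f w) (fun y => u <= y <= v) x.
Proof.
intros Hu Hv Hx Hf Hw.
destruct (continue_in_bounded f Hf) as [M HM].
apply (limit1_in_Series (fun k y => w k * f (tau_seq d k a y)) _ M r); auto.
- intros k y [Hy _]; apply weighted_bound; auto; lra.
- intros k; apply weighted_bound; auto; lra.
- intros k; apply limit_mul; [apply (limit_free (fun _ => w k) _ x x)|].
  intros eps Heps.
  destruct (Hf (tau_seq d k a x) ltac:(apply tau_seq_range; auto; lra) eps Heps)
    as [del [Hdel H]].
  exists del; split; [exact Hdel|].
  intros y [[Hy Hne] Hd].
  assert (E : tau_seq d k a y - tau_seq d k a x = (y - x) * / INR d ^ S k).
  { rewrite (tau_seq_affine d k a y), (tau_seq_affine d k a x) by lia; ring. }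
  pose proof (inv_pow_range k).
  apply H; split; [split; [apply tau_seq_range; auto; lra|]|].
  (* The slope is nonzero, so [tau_seq] is injective and the punctured neighbourhood of x is sent
     into a punctured one. *)
  + intros E'; rewrite E', Rminus_diag in E; symmetry in E.
    apply Rmult_integral in E; destruct E; lra.
  + simpl in Hd |- *; unfold Rdist in *; rewrite E, Rabs_mult, (Rabs_right (/ _)) by lra.
    pose proof (Rabs_pos (y - x)); nra.
Qed.

End Weighted.

Lemma C2_on_Sfun (d : nat) (lam : R) (A : R -> R) (a : nat -> nat) (u v : R) :
  (1 <= d)%nat -> 0 <= lam < 1 -> C2_on 0 1 A -> Sigma d a -> 0 <= u -> v <= 1 ->
  C2_on u v (fun x => Sfun d lam A x a).
Proof.
intros Hd Hlam [A1 [A2 HA]] Ha Hu Hv.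
(* Dividing by d^(k+1) keeps the weights below lambda^k, so differentiation can be repeated. *)
assert (Hw : forall w : nat -> R, (forall k, Rabs (w k) <= lam ^ k) ->
  forall k, Rabs (w k * / INR d ^ S k) <= lam ^ k).
{ intros w H k; pose proof (inv_pow_range d Hd k); pose proof (Rabs_pos (w k)).
  specialize (H k); rewrite Rabs_mult, (Rabs_right (/ _)) by lra; nra. }
assert (Hw0 : forall k, Rabs (lam ^ k) <= lam ^ k).
{ intros k; rewrite Rabs_right; [lra|apply Rle_ge, pow_le; lra]. }
exists (weighted_sum d a A1 (fun k => lam ^ k * / INR d ^ S k)),
  (weighted_sum d a A2 (fun k => lam ^ k * / INR d ^ S k * / INR d ^ S k)).
intros x Hx; split; [|split].
- apply (D_in_weighted_sum d a lam Hd Ha Hlam A A1 (fun k => lam ^ k)); auto.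
  + apply HA.
  + apply continue_in_bounded; intros y Hy; apply (cont_deriv _ A2), HA, Hy.
- apply (D_in_weighted_sum d a lam Hd Ha Hlam A1 A2 (fun k => lam ^ k * / INR d ^ S k)); auto.
  + apply HA.
  + apply continue_in_bounded; intros y Hy; apply HA, Hy.
- apply (continue_in_weighted_sum d a lam Hd Ha Hlam A2); auto; [apply HA|].
  exact (Hw _ (Hw _ Hw0)).
Qed.

(** * The upper boundary of the attractor is the graph of b *)

Lemma le0_of_geom (lam C x : R) :
  0 < lam < 1 -> (forall n, x <= C * lam ^ n) -> x <= 0.
Proof.
intros Hl H.
assert (Hg : is_lim_seq (fun n => C * lam ^ n) 0).
{ replace (Finite 0) with (Rbar_mult C 0) by (simpl; f_equal; ring).
  apply is_lim_seq_scal_l, is_lim_seq_geom; rewrite Rabs_right; lra. }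
exact (is_lim_seq_le _ _ _ _ H (is_lim_seq_const x) Hg).
Qed.

Lemma Tmap_tau (d i : nat) (x : R) :
  symbol d i -> in_circle x -> Tmap d (tau d i x) = x.
Proof.
intros [H1 H2] [Hx0 Hx1]; unfold Tmap, tau.
replace (INR d * ((x + INR i - 1) / INR d)) with (x + IZR (Z.of_nat i - 1)).
- unfold frac_part.
  rewrite <- (Int_part_spec (x + IZR (Z.of_nat i - 1)) (Z.of_nat i - 1)); lra.
- rewrite minus_IZR, <- INR_IZR_INZ; field; apply not_0_INR; lia.
Qed.

Lemma tau_Tmap (d : nat) (y : R) :
  (1 <= d)%nat -> in_circle y -> exists i, symbol d i /\ y = tau d i (Tmap d y).
Proof.
intros Hd [Hy0 Hy1].
assert (Hd' : 1 <= INR d) by (apply (le_INR 1); exact Hd).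
unfold Tmap, frac_part; set (z := Int_part (INR d * y)).
destruct (base_Int_part (INR d * y)) as [Hz1 Hz2]; fold z in Hz1, Hz2.
assert (Hz0 : (0 <= z)%Z).
{ assert (-1 < z)%Z; [|lia]. apply lt_IZR; nra. }
assert (Hzd : (z < Z.of_nat d)%Z).
{ apply lt_IZR; rewrite <- INR_IZR_INZ; nra. }
(* Symbols start at 1, so the branch through y is the integer part of d y plus one. *)
exists (S (Z.to_nat z)); split; [split; lia|].
unfold tau; rewrite S_INR, (INR_IZR_INZ (Z.to_nat z)), Z2Nat.id by exact Hz0.
field; lra.
Qed.

Lemma tau_increasing (d i : nat) (x y : R) :
  (1 <= d)%nat -> x < y -> tau d i x < tau d i y.
Proof.
intros Hd Hxy; unfold tau, Rdiv.
apply Rmult_lt_compat_r; [apply Rinv_0_lt_compat, lt_0_INR; lia|lra].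
Qed.

Lemma tau_circle (d i : nat) (x : R) :
  (1 <= d)%nat -> symbol d i -> in_circle x -> in_circle (tau d i x).
Proof.
intros Hd Hi [Hx0 Hx1]; split.
- apply tau_range; auto; lra.
- apply Rlt_le_trans with (tau d i 1); [apply tau_increasing; auto|].
  apply tau_range; auto; lra.
Qed.

(** Along a backward orbit, the height above the graph of [b] is at most lambda times the height one
    step further back. These heights are bounded above, so iteration shows that the initial one is
    at most 0. *)
Lemma attractor_bound (d : nat) (lam : R) (A b : R -> R) (x s : R) :
  (1 <= d)%nat -> 0 < lam < 1 -> calibrated_subaction d lam A b ->
  attractor d lam A (x, s) -> s <= b x.
Proof.
intros Hd Hlam [_ [Hcont Hmax]] [z [Hz0 [Hzc [HzF [M HM]]]]].
destruct (continuity_bounded b 0 1 ltac:(lra) Hcont) as [Mb HMb].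
(* The base point of [z (S n)] is a preimage of that of [z n], hence its image under some branch;
   calibration bounds [b] from below by the value of that branch. *)
assert (Hstep : forall n, snd (z n) - b (fst (z n)) <=
  lam * (snd (z (S n)) - b (fst (z (S n))))).
{ intros n.
  pose proof (f_equal fst (HzF n)) as E1; pose proof (f_equal snd (HzF n)) as E2.
  unfold Fmap in E1, E2; simpl fst in E1; simpl snd in E2.
  destruct (tau_Tmap d (fst (z (S n))) Hd (Hzc (S n))) as [i [Hi Hy]].
  destruct (Hmax (fst (z n)) (Hzc n)) as [_ Hub].
  specialize (Hub (branch_value d lam A b i (fst (z n))) (ex_intro _ i (conj Hi eq_refl))).
  unfold branch_value in Hub; rewrite <- E1, <- Hy, E1 in Hub; lra. }
assert (Hit : forall n, s - b x <= lam ^ n * (snd (z n) - b (fst (z n)))).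
{ induction n as [|n IH].
  - rewrite Hz0; simpl; lra.
  - eapply Rle_trans; [exact IH|].
    replace (lam ^ S n) with (lam ^ n * lam) by (simpl; ring).
    rewrite Rmult_assoc; apply Rmult_le_compat_l; [apply pow_le; lra|apply Hstep]. }
enough (s - b x <= 0) by lra.
apply (le0_of_geom lam (M + Mb)); [exact Hlam|].
intros n; eapply Rle_trans; [apply Hit|].
rewrite Rmult_comm; apply Rmult_le_compat_r; [apply pow_le; lra|].
specialize (HM n); specialize (HMb (fst (z n)) ltac:(destruct (Hzc n); lra)).
pose proof (Rle_abs (snd (z n))); pose proof (Rle_abs (- b (fst (z n)))).
rewrite Rabs_Ropp in *; lra.
Qed.

(** A backward orbit inside the graph is built by always following a maximizing branch; it is
    bounded because [b] is. *)
Lemma attractor_graph (d : nat) (lam : R) (A b : R -> R) (x : R) :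
  (1 <= d)%nat -> calibrated_subaction d lam A b -> in_circle x ->
  attractor d lam A (x, b x).
Proof.
intros Hd [_ [Hcont Hmax]] Hx.
destruct (continuity_bounded b 0 1 ltac:(lra) Hcont) as [Mb HMb].
assert (Hsel : forall y, exists i, in_circle y -> symbol d i /\ b y = branch_value d lam A b i y).
{ intros y; destruct (classic (in_circle y)) as [Hy|Hy].
  - destruct (Hmax y Hy) as [[i Hi] _]; exists i; auto.
  (* Arbitrary value off the circle: choice needs a selection at every real number. *)
  - exists 0%nat; tauto. }
destruct (functional_choice _ Hsel) as [c Hc].
set (y := fun n => Nat.iter n (fun w => tau d (c w) w) x).
assert (Hy : forall n, in_circle (y n)).
{ induction n as [|n IH]; [exact Hx|].
  change (y (S n)) with (tau d (c (y n)) (y n)).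
  apply tau_circle; auto; apply Hc, IH. }
exists (fun n => (y n, b (y n))); split; [reflexivity|split; [exact Hy|split]].
- intros n; destruct (Hc (y n) (Hy n)) as [Hi E].
  unfold Fmap; simpl fst; simpl snd.
  change (y (S n)) with (tau d (c (y n)) (y n)).
  rewrite Tmap_tau by auto; f_equal; symmetry; exact E.
- exists Mb; intros n; apply HMb; destruct (Hy n); lra.
Qed.

Lemma upper_boundary_graph (d : nat) (lam : R) (A b : R -> R) (x s : R) :
  (1 <= d)%nat -> 0 < lam < 1 -> calibrated_subaction d lam A b ->
  (upper_boundary d lam A (x, s) <-> in_circle x /\ s = b x).
Proof.
intros Hd Hlam Hb; split.
- intros [Hat Htop].
  assert (Hx : in_circle x).
  { destruct Hat as [z [Hz0 [Hzc _]]]; specialize (Hzc 0%nat); rewrite Hz0 in Hzc; exact Hzc. }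
  split; [exact Hx|].
  apply Rle_antisym.
  + apply (attractor_bound d lam A b); auto.
  + apply (Htop (b x)), attractor_graph; auto.
- intros [Hx ->]; split; [apply attractor_graph; auto|].
  intros s Hs; apply (attractor_bound d lam A b); auto.
Qed.

(** * One maximal branch between turning points, and the resulting expansion of b *)

Lemma continuity_zero_closure (h : R -> R) (u v : R) :
  u < v -> continuity h -> (forall x, u < x < v -> h x = 0) ->
  forall x, u <= x <= v -> h x = 0.
Proof.
intros Huv Hc Hz x Hx.
destruct (Req_dec (h x) 0) as [E|E]; [exact E|exfalso].
destruct (Hc x (Rabs (h x)) (Rabs_pos_lt _ E)) as [del [Hdel H]].
(* Moving from x by the fraction s towards the midpoint lands strictly inside (u,v) and within [del]
   of x. *)
set (s := Rmin (1 / 2) (del / (2 * (v - u)))).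
assert (Hs : 0 < s <= 1 / 2).
{ split; [|apply Rmin_l]; apply Rmin_glb_lt; [lra|apply Rdiv_lt_0_compat; lra]. }
assert (Hs' : s * (v - u) < del).
{ apply Rle_lt_trans with (del / 2); [|lra].
  replace (del / 2) with (del / (2 * (v - u)) * (v - u)) by (field; lra).
  apply Rmult_le_compat_r; [lra|apply Rmin_r]. }
set (y := x + s * ((u + v) / 2 - x)).
assert (Hy : u < y < v) by (unfold y; nra).
assert (Hxy : Rabs (y - x) < del).
{ replace (y - x) with (s * ((u + v) / 2 - x)) by (unfold y; ring).
  apply Rabs_def1; nra. }
destruct (Req_dec y x) as [E'|E']; [apply E; rewrite <- E'; auto|].
specialize (H y); simpl in H; unfold Rdist in H.
rewrite (Hz y Hy), Rminus_0_l, Rabs_Ropp in H.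
apply (Rlt_irrefl (Rabs (h x))), H; repeat split; auto.
Qed.

(** Products express that one of finitely many functions vanishes through the zeros of a single
    continuous function, to which the intermediate value theorem applies. *)
Lemma prod_f_R0_eq0 (f : nat -> R) (n : nat) :
  prod_f_R0 f n = 0 <-> exists k, (k <= n)%nat /\ f k = 0.
Proof.
induction n as [|n IH]; simpl.
- split; [intros H; exists 0%nat; auto|intros [k [Hk H]]].
  replace 0%nat with k by lia; exact H.
- split.
  + intros H; apply Rmult_integral in H; destruct H as [H|H].
    * apply IH in H; destruct H as [k [Hk H]]; exists k; auto.
    * exists (S n); auto.
  + intros [k [Hk H]]; destruct (Nat.eq_dec k (S n)) as [->|Hne].
    * rewrite H; ring.
    * rewrite (proj2 IH); [ring|exists k; split; [lia|exact H]].
Qed.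

Lemma prod_f_R0_ge0 (f : nat -> R) (n : nat) :
  (forall k, (k <= n)%nat -> 0 <= f k) -> 0 <= prod_f_R0 f n.
Proof.
induction n as [|n IH]; simpl; intros H; [auto|].
apply Rmult_le_pos; auto.
Qed.

Lemma continuity_prod_f_R0 (f : nat -> R -> R) (n : nat) :
  (forall k, continuity (f k)) -> continuity (fun x => prod_f_R0 (fun k => f k x) n).
Proof.
intros H; induction n as [|n IH]; simpl; [apply H|].
apply (continuity_mult (fun x => prod_f_R0 (fun k => f k x) n) (f (S n))); auto.
Qed.

Lemma lipschitz_continuity (f : R -> R) : lipschitz f -> continuity f.
Proof.
intros [K HK] x eps Heps.
exists (eps / (Rabs K + 1)); pose proof (Rabs_pos K).
split; [apply Rdiv_lt_0_compat; lra|].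
intros y [_ Hy]; simpl in *; unfold Rdist in *.
apply Rle_lt_trans with ((Rabs K + 1) * Rabs (y - x)).
- pose proof (Rle_abs K); pose proof (Rabs_pos (y - x)).
  eapply Rle_trans; [apply HK|nra].
- apply Rlt_div_r in Hy; lra.
Qed.

Lemma continuity_branch (d : nat) (lam : R) (A b : R -> R) (i : nat) :
  lipschitz A -> continuity b -> continuity (branch_value d lam A b i).
Proof.
intros HA Hb.
assert (Ht : continuity (tau d i)) by (unfold tau; intros x; reg).
apply (continuity_plus (fun x => lam * b (tau d i x)) (fun x => A (tau d i x))).
- apply (continuity_scal (fun x => b (tau d i x))).
  apply (continuity_comp (tau d i) b); assumption.
- apply (continuity_comp (tau d i) A); [assumption|apply lipschitz_continuity, HA].
Qed.

(** Take the branch that is maximal at the midpoint, and compare its defect with the product of the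
    defects of all other branches. Both are nonnegative, and without turning points exactly one of
    them vanishes at each interior point. They therefore never agree, and by connectedness the same
    one vanishes throughout. *)
Lemma single_branch (d : nat) (lam : R) (A b : R -> R) (u v : R) :
  (1 <= d)%nat -> lipschitz A -> calibrated_subaction d lam A b ->
  0 <= u -> u < v -> v <= 1 ->
  (forall x, u < x < v -> ~ turning_point d lam A b x) ->
  exists i, symbol d i /\ forall x, u <= x <= v -> b x = branch_value d lam A b i x.
Proof.
intros Hd HA [_ [Hcont Hmax]] Hu Huv Hv Hnt.
set (m := (u + v) / 2).
destruct (Hmax m ltac:(unfold m; split; lra)) as [[i [Hi Em]] _].
exists i; split; [exact Hi|].
set (h := fun j x => b x - branch_value d lam A b j x).
assert (Hhc : forall j, continuity (h j)).
{ intros j; apply (continuity_minus b (branch_value d lam A b j)); auto.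
  apply continuity_branch; auto. }
assert (Hh0 : forall j x, symbol d j -> u < x < v -> 0 <= h j x).
{ intros j x Hj Hx; destruct (Hmax x ltac:(split; lra)) as [_ Hub].
  specialize (Hub _ (ex_intro _ j (conj Hj eq_refl))); unfold h; lra. }
assert (Huniq : forall j k x, symbol d j -> symbol d k -> u < x < v ->
  h j x = 0 -> h k x = 0 -> j = k).
{ intros j k x Hj Hk Hx Ej Ek; unfold h in Ej, Ek.
  destruct (Nat.eq_dec j k) as [E|E]; [exact E|].
  exfalso; apply (Hnt x Hx); split; [split; lra|].
  exists j, k; repeat split; auto; try apply Hj; try apply Hk; lra. }
(* Factor k belongs to the symbol k+1; the factor of [i] is replaced by 1, which removes it from the
   product. *)
set (f := fun k x => if Nat.eq_dec (S k) i then 1 else h (S k) x).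
set (p := fun x => prod_f_R0 (fun k => f k x) (d - 1)).
assert (Hfc : continuity (fun x => h i x - p x)).
{ apply (continuity_minus (h i) p); auto; apply continuity_prod_f_R0; intros k.
  unfold f; destruct Nat.eq_dec; [apply continuity_const; intros ? ?; reflexivity|apply Hhc]. }
assert (Hp0 : forall x, u < x < v -> 0 <= p x).
{ intros x Hx; apply prod_f_R0_ge0; intros k Hk; unfold f.
  destruct Nat.eq_dec; [lra|apply Hh0; [split; lia|exact Hx]]. }
assert (Hpz : forall x, u < x < v -> (p x = 0 <-> h i x <> 0)).
{ intros x Hx; unfold p; rewrite prod_f_R0_eq0; split.
  - intros [k [Hk E]] Ei; unfold f in E; destruct Nat.eq_dec as [Ek|Ek]; [lra|].
    apply Ek, (Huniq (S k) i x); auto; split; lia.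
  - intros Hne; destruct (Hmax x ltac:(split; lra)) as [[j [Hj Ej]] _].
    destruct j as [|k]; [destruct Hj; lia|].
    exists k; destruct Hj; split; [lia|].
    unfold f, h; destruct Nat.eq_dec as [Ek|Ek]; [|lra].
    exfalso; apply Hne; rewrite <- Ek; unfold h; lra. }
assert (Hm : u < m < v) by (unfold m; lra).
assert (Ehm : h i m = 0) by (unfold h; lra).
intros x Hx.
enough (h i x = 0) by (unfold h in *; lra).
apply (continuity_zero_closure (h i) u v); auto.
clear x Hx; intros x Hx.
destruct (Req_dec (h i x) 0) as [E|E]; [exact E|exfalso].
(* The difference [h i - p] is nonpositive at m, where [h i] vanishes, and nonnegative at x, where
   [p] vanishes. A zero between them would make the two equal. *)
destruct (IVT_gen _ m x 0 Hfc) as [c [Hc Ec]].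
- cbv beta; rewrite Ehm, (proj2 (Hpz x Hx) E).
  specialize (Hp0 m Hm); specialize (Hh0 i x Hi Hx).
  unfold Rmin, Rmax; repeat destruct Rle_dec; lra.
- assert (Hc' : u < c < v).
  { unfold Rmin, Rmax in Hc; destruct (Rle_dec m x); lra. }
  cbv beta in Ec; destruct (Req_dec (h i c) 0) as [Z|Z].
  + apply (proj1 (Hpz c Hc')); lra.
  + pose proof (proj2 (Hpz c Hc') Z); lra.
Qed.

(** Unfolding the calibration equation n+1 times leaves the remainder lambda^(n+1) b(tau_{n,a} x),
    which tends to 0 because [b] is bounded on [0,1]. *)
Lemma calibrated_expansion (d : nat) (lam : R) (A b : R -> R) (a : nat -> nat) (x : R) :
  0 < lam < 1 -> Sigma d a -> continuity b -> 0 <= x <= 1 ->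
  b x = branch_value d lam A b (a 0%nat) x ->
  (forall k, b (tau_seq d k a x) = branch_value d lam A b (a (S k)) (tau_seq d k a x)) ->
  b x = Sfun d lam A x a.
Proof.
intros Hlam Ha Hcont Hx E0 ES.
destruct (continuity_bounded b 0 1 ltac:(lra) Hcont) as [M HM].
symmetry; apply is_series_unique.
assert (E : forall n, sum_n (fun k => lam ^ k * A (tau_seq d k a x)) n =
  b x - lam * lam ^ n * b (tau_seq d n a x)).
{ induction n as [|n IH].
  - rewrite sum_O, E0; unfold branch_value; simpl; ring.
  - rewrite sum_Sn, IH, (ES n); unfold branch_value, plus; simpl; ring. }
change (is_lim_seq (sum_n (fun k => lam ^ k * A (tau_seq d k a x))) (b x)).
apply (is_lim_seq_ext (fun n => b x - lam * lam ^ n * b (tau_seq d n a x))).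
{ intros n; symmetry; apply E. }
replace (Finite (b x)) with (Finite (b x - 0)) by (f_equal; ring).
apply is_lim_seq_minus'; [apply is_lim_seq_const|].
apply is_lim_seq_abs_0.
apply (is_lim_seq_le_le (fun _ => 0) _ (fun n => M * lam ^ n)).
- intros n; split; [apply Rabs_pos|].
  assert (0 < lam ^ n) by (apply pow_lt; lra).
  specialize (HM _ (tau_seq_range d n a x Ha Hx)).
  assert (Hq : 0 <= lam * lam ^ n <= lam ^ n) by nra.
  rewrite Rabs_mult, (Rabs_right (lam * _)), (Rmult_comm M) by lra.
  apply Rmult_le_compat; try apply Rabs_pos; lra.
- apply is_lim_seq_const.
- replace (Finite 0) with (Rbar_mult M 0) by (simpl; f_equal; ring).
  apply is_lim_seq_scal_l, is_lim_seq_geom; rewrite Rabs_right; lra.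
Qed.

(** * Finite partitions of the interval and leaves over their gaps *)

(** Serves twice: with equality as [f] it lists the points of a finite set, and with forward orbits
    it lists a finite union of finite sets. *)
Lemma Finite_cover (P : R -> Prop) (f : R -> R -> Prop) :
  Finite_sets.Finite R P ->
  (forall x, P x -> exists l, forall y, f x y -> In y l) ->
  exists l, forall x y, P x -> f x y -> In y l.
Proof.
intros HP; induction HP as [|P HP IH p Hp]; intros H.
- exists nil; intros x y [].
- destruct IH as [l Hl].
  { intros x Hx; apply H; left; exact Hx. }
  destruct (H p) as [l' Hl']; [right; constructor|].
  exists (l ++ l'); intros x y Hx Hxy; apply in_or_app.
  destruct Hx as [x Hx|x Hx]; [left; exact (Hl x y Hx Hxy)|right].
  destruct Hx; auto.
Qed.

(** Induction on the list of cut points: a point strictly inside the interval splits it and the two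
    partitions are concatenated, while any other point is avoided by every open subinterval. *)
Lemma interval_partition (Q : R -> R -> (nat -> nat) -> Prop) (l : list R) :
  forall u v, u < v ->
  (forall u' v', u <= u' -> u' < v' -> v' <= v ->
    (forall x, In x l -> ~ u' < x < v') -> exists a, Q u' v' a) ->
  exists (n : nat) (t : nat -> R) (a : nat -> nat -> nat),
    t 0%nat = u /\ t n = v /\
    forall j, (j < n)%nat -> t j < t (S j) /\ Q (t j) (t (S j)) (a j).
Proof.
induction l as [|p l IH]; intros u v Huv H.
- destruct (H u v) as [a Ha]; try lra; [intros x []|].
  exists 1%nat, (fun k => match k with O => u | _ => v end), (fun _ => a).
  repeat split; replace j with 0%nat by lia; auto.
- destruct (classic (u < p < v)) as [Hp|Hp].
  + destruct (IH u p) as (n1 & t1 & a1 & Hu1 & Hv1 & H1); [lra| |].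
    { intros u' v' ? ? ? Hl; apply H; try lra.
      intros x [E|Hx]; [rewrite <- E; lra|apply Hl, Hx]. }
    destruct (IH p v) as (n2 & t2 & a2 & Hu2 & Hv2 & H2); [lra| |].
    { intros u' v' ? ? ? Hl; apply H; try lra.
      intros x [E|Hx]; [rewrite <- E; lra|apply Hl, Hx]. }
    (* At the junction index [n1] both partitions take the value p, so the second one may be read
       from there on. *)
    assert (Et : forall j, (n1 <= j)%nat ->
      (if le_lt_dec j n1 then t1 j else t2 (j - n1)%nat) = t2 (j - n1)%nat).
    { intros j Hj; destruct le_lt_dec; [|reflexivity].
      replace j with n1 by lia; rewrite Nat.sub_diag, Hu2; exact Hv1. }
    exists (n1 + n2)%nat, (fun j => if le_lt_dec j n1 then t1 j else t2 (j - n1)%nat),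
      (fun j => if le_lt_dec n1 j then a2 (j - n1)%nat else a1 j).
    split; [exact Hu1|split].
    * rewrite Et by lia; replace (n1 + n2 - n1)%nat with n2 by lia; exact Hv2.
    * intros j Hj; destruct (le_lt_dec n1 j) as [Hl|Hl].
      -- rewrite !Et by lia; replace (S j - n1)%nat with (S (j - n1)) by lia.
         apply H2; lia.
      -- destruct (le_lt_dec j n1); [|lia]; destruct (le_lt_dec (S j) n1); [|lia].
         apply H1, Hl.
  + apply IH; [exact Huv|].
    intros u' v' ? ? ? Hl; apply H; auto.
    intros x [E|Hx]; [rewrite <- E; lra|apply Hl, Hx].
Qed.

(* [P] is a forward invariant set containing the turning points: an interval that
   avoids [P] keeps avoiding it when it is pulled back along its maximal branch. *)
Lemma leaf_on_gap (d : nat) (lam : R) (A b : R -> R) (P : R -> Prop) (u v : R) :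
  (1 <= d)%nat -> 0 < lam < 1 -> lipschitz A -> calibrated_subaction d lam A b ->
  (forall x, turning_point d lam A b x -> P x) -> (forall x, P x -> P (Tmap d x)) ->
  0 <= u -> u < v -> v <= 1 -> (forall x, u < x < v -> ~ P x) ->
  exists a, Sigma d a /\ forall x, u <= x <= v -> b x = Sfun d lam A x a.
Proof.
intros Hd Hlam HA Hb HPt HPT Hu Huv Hv Hgap.
set (gap := fun q : R * R => 0 <= fst q /\ fst q < snd q /\ snd q <= 1 /\
  forall x, fst q < x < snd q -> ~ P x).
set (good := fun (q : R * R) (i : nat) => symbol d i /\
  (forall x, fst q <= x <= snd q -> b x = branch_value d lam A b i x) /\
  gap (tau d i (fst q), tau d i (snd q))).
assert (Hsel : forall q, exists i, gap q -> good q i).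
{ intros q; destruct (classic (gap q)) as [(Hq0 & Hq & Hq1 & HqP)|Hq]; [|exists 0%nat; tauto].
  destruct (single_branch d lam A b (fst q) (snd q)) as [i [Hi Hbr]]; auto.
  { intros x Hx Ht; exact (HqP x Hx (HPt x Ht)). }
  exists i; intros _; split; [exact Hi|split; [exact Hbr|]].
  assert (Hd0 : 0 < INR d) by (apply lt_0_INR; lia).
  split; [apply tau_range; auto; lra|split; [apply tau_increasing; auto|]].
  split; [apply tau_range; auto; lra|simpl; intros y Hy HPy].
  (* The preimage x of y under the branch lies in the original gap and equals T y; invariance of [P]
     would put it in [P]. *)
  assert (Hy' : y = tau d i (INR d * y - INR i + 1)) by (unfold tau; field; lra).
  set (x := INR d * y - INR i + 1) in Hy'.
  assert (Hx : fst q < x < snd q).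
  { rewrite Hy' in Hy; unfold tau, Rdiv in Hy; destruct Hy as [Hy1 Hy2].
    apply Rmult_lt_reg_r in Hy1; [|apply Rinv_0_lt_compat, Hd0].
    apply Rmult_lt_reg_r in Hy2; [|apply Rinv_0_lt_compat, Hd0]. lra. }
  apply (HqP x Hx); rewrite <- (Tmap_tau d i x Hi ltac:(split; lra)), <- Hy'; auto. }
destruct (functional_choice _ Hsel) as [c Hc].
(* Endpoints of the successive pullbacks of [u,v]. The symbol chosen on the n-th one is the n-th
   entry of the itinerary, the same for all points of [u,v]. *)
set (q := fun n => Nat.iter n (fun w => (tau d (c w) (fst w), tau d (c w) (snd w))) (u, v)).
assert (Hq : forall n, gap (q n)).
{ induction n as [|n IH]; [exact (conj Hu (conj Huv (conj Hv Hgap)))|].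
  apply (Hc (q n) IH). }
assert (Hgood : forall n, good (q n) (c (q n))) by (intros n; apply Hc, Hq).
set (a := fun n => c (q n)).
assert (Hmono : forall i y z, y <= z -> tau d i y <= tau d i z).
{ intros i y z [Hyz|E]; [left; apply tau_increasing; auto|rewrite E; lra]. }
exists a; split; [intros n; apply Hgood|].
intros x Hx.
(* [tau_seq] at index n composes n+1 branches, whence the shift in [q]. *)
assert (Hin : forall n, fst (q (S n)) <= tau_seq d n a x <= snd (q (S n))).
{ induction n as [|n IH]; [split; apply Hmono; apply Hx|].
  split; apply (Hmono (a (S n))); apply IH. }
apply (calibrated_expansion d lam A b a x); auto.
- intros n; apply Hgood.
- apply Hb.
- lra.
- apply (Hgood 0%nat); exact Hx.
- intros n; apply (Hgood (S n)), Hin.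
Qed.

(** * Assembly of the pieces *)

Lemma C2_on_ext (f g : R -> R) (u v : R) :
  (forall x, u <= x <= v -> f x = g x) -> C2_on u v g -> C2_on u v f.
Proof.
intros E [g1 [g2 H]]; exists g1, g2; intros x Hx.
destruct (H x Hx) as [H1 H2]; split; [|exact H2].
intros eps Heps; destruct (H1 eps Heps) as [del [Hdel Hlim]].
exists del; split; [exact Hdel|]; intros y [[Hy Hne] Hd].
rewrite (E x Hx), (E y Hy); apply Hlim; repeat split; auto; apply Hy.
Qed.

Theorem corollary2 (d : nat) (lam : R) (A b : R -> R)
  (hd : (2 <= d)%nat)
  (hlam : 0 < lam < 1)
  (hAper : periodic1 A)
  (hAlip : lipschitz A)
  (hAC2 : C2_on 0 1 A)
  (hb : calibrated_subaction d lam A b)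
  (htwist : twist_condition d lam A)
  (hfin : Finite_sets.Finite R (turning_point d lam A b))
  (hsimple : forall x : R, turning_point d lam A b x -> simple_point d x) :
  (forall x s : R, upper_boundary d lam A (x, s) <-> in_circle x /\ s = b x) /\
  exists (n : nat) (t : nat -> R) (a : nat -> nat -> nat),
    t 0%nat = 0 /\ t n = 1 /\
    forall j : nat, (j < n)%nat ->
      t j < t (S j) /\
      Sigma d (a j) /\
      C2_on (t j) (t (S j)) b /\
      (forall x : R, t j <= x <= t (S j) -> b x = Sfun d lam A x (a j)) /\
      (forall x : R, t j < x < t (S j) -> unstable_manifold d lam A (a j) (x, b x)).
Proof.
assert (hd1 : (1 <= d)%nat) by lia.
split; [intros x s; apply upper_boundary_graph; auto|].
(* The list [l] contains the forward orbits of all turning points; its entries are the cut points of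
   the partition. *)
destruct (Finite_cover (turning_point d lam A b) (forward_orbit d) hfin) as [l Hl].
{ intros x Hx; destruct (Finite_cover _ (fun y z => y = z) (hsimple x Hx)) as [l Hl].
  - intros y _; exists (y :: nil); intros z <-; left; reflexivity.
  - exists l; intros y Hy; exact (Hl y y Hy eq_refl). }
set (P := fun y => exists x, turning_point d lam A b x /\ forward_orbit d x y).
apply (interval_partition (fun u v a => Sigma d a /\ C2_on u v b /\
  (forall x, u <= x <= v -> b x = Sfun d lam A x a) /\
  (forall x, u < x < v -> unstable_manifold d lam A a (x, b x))) l 0 1 ltac:(lra)).
intros u v Hu Huv Hv Hgap.
destruct (leaf_on_gap d lam A b P u v) as [a [Ha E]]; auto.
- intros x Hx; exists x; split; [exact Hx|exists 0%nat; reflexivity].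
- intros y [x [Hx [n ->]]]; exists x; split; [exact Hx|exists (S n); reflexivity].
- intros y Hy [x [Hx Hxy]]; exact (Hgap y (Hl x y Hx Hxy) Hy).
- exists a; split; [exact Ha|split; [|split; [exact E|]]].
  + apply (C2_on_ext _ _ u v E), C2_on_Sfun; auto; lra.
  + intros x Hx; split; simpl; [lra|apply E; lra].
Qed.
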